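(* Let $0<m<M$, let $r>0$, and let $\mathrm{ORA}_r$ be the algorithm which, given prediction $p\in[m,M]$, accepts the first revealed price that is at least $r\cdot p$ (and, if no such price appears, accepts the last price by default). Then for every input with prediction $p$ and price sequence $\sigma$, the ratio $p^*/\mathrm{ORA}_r(\sigma)$ is at most $(1-\eta)/r$ if the error is negative and $\eta\le 1-r$; $(1-\eta)M/m$ if the error is negative and $\eta>1-r$; $(1+\eta)/r$ if the error is positive and $\eta\ge r-1$; $M/m$ if the error is positive and $\eta<r-1$.
   Context: Online search problem: $0<m<M$ are known bounds. A sequence of prices $\sigma_1,\dots,\sigma_d\in[m,M]$ (with $d\ge1$ unknown to the player) is revealed one per day. When $\sigma_i$ is revealed the player irrevocably either accepts it (its profit is $\sigma_i$) or rejects it; if $\sigma_1,\dots,\sigma_{d-1}$ are all rejected, $\sigma_d$ is accepted by default. $\mathrm{ORA}_r(\sigma)$ denotes the accepted price. Let $p^*=\max_i\sigma_i$. The algorithm receives a prediction $p\in[m,M]$ of $p^*$. If $p^*\le p$ the error is negative and $\eta$ is defined by $1-\eta=p^*/p$; if $p^*>p$ the error is positive and $\eta$ is defined by $1+\eta=p^*/p$. *)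

(* Defs.v *)
From mathcomp Require Import all_boot all_order all_algebra.

Set Implicit Arguments.
Unset Strict Implicit.
Unset Printing Implicit Defensive.

Import Order.TTheory GRing.Theory Num.Theory.
Local Open Scope ring_scope.

Section OnlineSearch.
Variable R : realFieldType.

(* Profit when prices are revealed one by one and the player accepts the
   first price satisfying [accept]; the last price is accepted by default.
   The value 0 on the empty sequence is a dummy. *)
Fixpoint online_profit (accept : pred R) (sigma : seq R) : R :=
  match sigma with
  | [::] => 0
  | [:: x] => x
  | x :: s => if accept x then x else online_profit accept s
  end.

Definition ORA (r p : R) (sigma : seq R) : R :=
  online_profit (fun x => r * p <= x) sigma.

(* The maximum of a nonempty sequence. *)
Definition max_price (sigma : seq R) : R :=
  \big[Num.max/head 0 sigma]_(x <- sigma) x.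

Definition negative_error (p : R) (sigma : seq R) : Prop := max_price sigma <= p.

Definition positive_error (p : R) (sigma : seq R) : Prop := p < max_price sigma.

(* For p != 0 this determines eta uniquely. *)
Definition is_error (p : R) (sigma : seq R) (eta : R) : Prop :=
  (negative_error p sigma -> 1 - eta = max_price sigma / p) /\
  (positive_error p sigma -> 1 + eta = max_price sigma / p).

End OnlineSearch.

(* Main.v *)
(** The maximum price is itself revealed, so as soon as it reaches the
    threshold [r * p] the algorithm accepts a price of at least [r * p]; since
    [max_price sigma / p] is [1 - eta] or [1 + eta], this is exactly the
    condition of the two cases with denominator [r]. Otherwise only
    [m <= ORA r p sigma] is known, and the bounds follow from
    [max_price sigma <= M] and [p <= M]. *)

Require Import Defs.
From mathcomp Require Import all_boot all_order all_algebra.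

Import Order.TTheory GRing.Theory Num.Theory.
Local Open Scope ring_scope.

Lemma online_profit_mem (R : realFieldType) (accept : pred R) (s : seq R) :
  (0 < size s)%N -> online_profit accept s \in s.
Proof.
elim: s => [//|x [|y s] IH] _; first by rewrite mem_head.
rewrite [online_profit _ _]/=; case: ifP => _; first by rewrite mem_head.
by rewrite inE IH ?orbT.
Qed.

(** By induction: a rejected head leaves the acceptable price in the tail, and once a single price
    is left it must be that one, so acceptance by default does no harm. *)
Lemma online_profit_accepted (R : realFieldType) (accept : pred R) (s : seq R) :
  has accept s -> accept (online_profit accept s).
Proof.
elim: s => [//|x [|y s] IH]; first by rewrite has_seq1.
rewrite [online_profit _ _]/= [has _ _]/=.
by case: ifP => [-> //|_ /=]; apply: IH.
Qed.

(** The fold starts from [head 0 s], itself a member when [s] is nonempty, and [Num.max] always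
    returns one of its arguments. *)
Lemma max_price_mem (R : realFieldType) (s : seq R) :
  (0 < size s)%N -> max_price s \in s.
Proof.
case: s => [//|x s] _; rewrite /max_price [head _ _]/=.
rewrite big_seq; apply: (big_ind (fun y => y \in x :: s)) => //.
  exact: mem_head.
by move=> y z ys zs; rewrite /Num.max; case: ifP.
Qed.

Lemma ORA_ge_threshold (R : realFieldType) (r p : R) (s : seq R) :
  (0 < size s)%N -> r * p <= max_price s -> r * p <= ORA r p s.
Proof.
move=> s_gt0 le_max; apply: (@online_profit_accepted R (fun x => r * p <= x)).
by apply/hasP; exists (max_price s) => //; apply: max_price_mem.
Qed.

Lemma ratio_le_threshold (R : realFieldType) (r p : R) (s : seq R) :
  0 < r -> 0 < p -> (0 < size s)%N -> r <= max_price s / p ->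
  max_price s / ORA r p s <= max_price s / p / r.
Proof.
move=> r0 p0 s_gt0; rewrite ler_pdivlMr // => le_max.
have rp0 : 0 < r * p by apply: mulr_gt0.
have rpO := ORA_ge_threshold R r p s s_gt0 le_max.
(* With the factor [max_price s] cancelled, it remains to compare the inverses of [ORA r p s] and
   [r * p]. *)
rewrite -mulrA -invfM [p * r]mulrC ler_wpM2l ?(ltW (lt_le_trans rp0 _)) //.
by rewrite lef_pV2 // posrE (lt_le_trans rp0).
Qed.

Theorem theorem2 (R : realFieldType) (m M r p eta : R) (sigma : seq R)
    (hm : 0 < m) (hmM : m < M) (hr : 0 < r) (hp : m <= p <= M)
    (hd : (1 <= size sigma)%N)
    (hsigma : forall x : R, x \in sigma -> m <= x <= M)
    (heta : is_error p sigma eta) :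
  (negative_error p sigma -> eta <= 1 - r ->
     max_price sigma / ORA r p sigma <= (1 - eta) / r) /\
  (negative_error p sigma -> 1 - r < eta ->
     max_price sigma / ORA r p sigma <= (1 - eta) * M / m) /\
  (positive_error p sigma -> r - 1 <= eta ->
     max_price sigma / ORA r p sigma <= (1 + eta) / r) /\
  (positive_error p sigma -> eta < r - 1 ->
     max_price sigma / ORA r p sigma <= M / m).
Proof.
have [mp pM] := andP hp.
have p0 : 0 < p := lt_le_trans hm mp.
have [mmax maxM] := andP (hsigma _ (max_price_mem R sigma hd)).
have max0 : 0 < max_price sigma := lt_le_trans hm mmax.
have [mO _] : m <= ORA r p sigma /\ ORA r p sigma <= M.
  by apply/andP/hsigma/online_profit_mem.
have ratio_m : max_price sigma / ORA r p sigma <= max_price sigma / m.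
  by rewrite ler_wpM2l ?(ltW max0) // lef_pV2 ?posrE // (lt_le_trans hm).
have [hneg hpos] := heta.
split; [|split; [|split]] => err.
(* The condition on [eta] becomes [r <= 1 - eta], and [hneg] turns [1 - eta] into
   [max_price sigma / p] both there and in the bound. *)
- rewrite lerBrDl -lerBrDr hneg //; exact: ratio_le_threshold.
- move=> _; apply: le_trans ratio_m _; rewrite hneg //.
  rewrite ler_wpM2r ?invr_ge0 ?(ltW hm) //.
  (* The factor [M / p] is at least 1. *)
  by rewrite -mulrA ler_peMr ?(ltW max0) // mulrC ler_pdivlMr // mul1r.
- rewrite lerBlDl hpos //; exact: ratio_le_threshold.
- by move=> _; apply: le_trans ratio_m _; rewrite ler_wpM2r // invr_ge0 ltW.
Qed.
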